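(* Every relational structure $\Gamma$ with domain $\mathbb{Q}$, a finite relational signature $\tau$, and all of whose relations are first-order definable in $(\mathbb{Q};<)$ has an efficient sampling algorithm. Moreover, on input $n$ the output of the algorithm is a structure of size $n$.
   Context: A sampling algorithm for $\Gamma$, on input a positive integer $n$, outputs a finite $\tau$-structure $B$ isomorphic to an induced substructure of $\Gamma$ such that every $\tau$-structure $A$ with $n$ elements has a homomorphism to $B$ if and only if it has a homomorphism to $\Gamma$; it is efficient if its running time is bounded by a polynomial in $n$. *)

(* Defs.v *)
From mathcomp Require Import all_boot all_order all_algebra.

Set Implicit Arguments.
Unset Strict Implicit.
Unset Printing Implicit Defensive.

(** * Relational structures *)

Record signature := Signature { symbol : finType; arity : symbol -> nat }.
Arguments arity {s} _.

Definition structure (tau : signature) (D : Type) : Type :=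
  forall R : symbol tau, (arity R).-tuple D -> Prop.

Definition is_hom (tau : signature) (D E : Type)
    (A : structure tau D) (B : structure tau E) (f : D -> E) : Prop :=
  forall (R : symbol tau) (t : (arity R).-tuple D),
    A R t -> B R (map_tuple f t).

Definition homomorphic (tau : signature) (D E : Type)
    (A : structure tau D) (B : structure tau E) : Prop :=
  exists f : D -> E, is_hom A B f.

Definition isomorphic (tau : signature) (D E : Type)
    (A : structure tau D) (B : structure tau E) : Prop :=
  exists f : D -> E, bijective f /\
    forall (R : symbol tau) (t : (arity R).-tuple D),
      A R t <-> B R (map_tuple f t).

Definition induced (tau : signature) (D : Type) (A : structure tau D)
    (S : pred D) : structure tau {x : D | S x} :=
  fun R t => A R (map_tuple sval t).
Arguments induced {tau D} A S _ _.

Definition finstructure (tau : signature) (m : nat) : Type :=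
  forall R : symbol tau, {set (arity R).-tuple 'I_m}.

Definition structure_of_fin (tau : signature) (m : nat)
    (B : finstructure tau m) : structure tau 'I_m :=
  fun R t => t \in B R.

(** * First-order definability (without parameters) *)

(* [formula sigma k] is the type of first-order formulas with equality whose
   free variables are among 'I_k.  The quantifiers bind variable 0 of their
   body, and variable i of the context becomes variable i.+1. *)
Inductive formula (sigma : signature) : nat -> Type :=
| Atom k (R : symbol sigma) (x : (arity R).-tuple 'I_k) : formula sigma k
| Equal k (x y : 'I_k) : formula sigma k
| Not k (phi : formula sigma k) : formula sigma k
| And k (phi psi : formula sigma k) : formula sigma k
| Or k (phi psi : formula sigma k) : formula sigma k
| Exists k (phi : formula sigma k.+1) : formula sigma k
| Forall k (phi : formula sigma k.+1) : formula sigma k.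

Fixpoint satisfies (sigma : signature) (D : Type) (M : structure sigma D)
    (k : nat) (phi : formula sigma k) : k.-tuple D -> Prop :=
  match phi in formula _ k return k.-tuple D -> Prop with
  | Atom _ R x => fun v => M R (map_tuple (tnth v) x)
  | Equal _ x y => fun v => tnth v x = tnth v y
  | Not _ phi => fun v => ~ satisfies M phi v
  | And _ phi psi => fun v => satisfies M phi v /\ satisfies M psi v
  | Or _ phi psi => fun v => satisfies M phi v \/ satisfies M psi v
  | Exists _ phi => fun v => exists a : D, satisfies M phi (cons_tuple a v)
  | Forall _ phi => fun v => forall a : D, satisfies M phi (cons_tuple a v)
  end.

Definition fo_definable (sigma : signature) (D : Type) (M : structure sigma D)
    (k : nat) (P : k.-tuple D -> Prop) : Prop :=
  exists phi : formula sigma k, forall v : k.-tuple D, P v <-> satisfies M phi v.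

Definition order_signature : signature := @Signature unit (fun=> 2).

Definition rat_order : structure order_signature rat :=
  fun (_ : unit) (t : 2.-tuple rat) => (tnth t ord0 < tnth t ord_max)%R.

(** * Deterministic multitape Turing machines *)

Inductive move := MoveLeft | Stay | MoveRight.

(* [None] is the blank, [Some (inl b)] an input/output bit, and [Some (inr a)]
   an auxiliary symbol. *)
Definition cell (W : finType) : Type := option (bool + W).

(* The machine has [ntapes.+1] tapes, each infinite to the right only. *)
Record machine := Machine {
  ntapes : nat;
  state : finType;
  work : finType;
  start : state;
  halting : pred state;
  trans : state -> {ffun 'I_ntapes.+1 -> cell work} ->
    state * ('I_ntapes.+1 -> cell work * move) }.

Record config (M : machine) := Config {
  cur : state M;
  tape : 'I_(ntapes M).+1 -> nat -> cell (work M);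
  head : 'I_(ntapes M).+1 -> nat }.

Definition shift (d : move) (p : nat) : nat :=
  match d with MoveLeft => p.-1 | Stay => p | MoveRight => p.+1 end.

Definition step (M : machine) (c : config M) : config M :=
  if halting (cur c) then c else
  let: (q, act) := trans (cur c) [ffun i => tape c i (head c i)] in
  Config q
    (fun i p => if p == head c i then (act i).1 else tape c i p)
    (fun i => shift (act i).2 (head c i)).

Definition word_tape (W : finType) (w : seq bool) : nat -> cell W :=
  nth None [seq Some (inl b) | b <- w].

(* The input word is on the first tape, all other tapes are blank, and all
   heads are on the leftmost cell. *)
Definition init (M : machine) (w : seq bool) : config M :=
  Config (start M)
    (fun i => if i == ord0 then @word_tape (work M) w else fun=> None)
    (fun=> 0).

Definition run (M : machine) (w : seq bool) (t : nat) : config M :=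
  iter t (@step M) (init M w).

Definition halts_at (M : machine) (w : seq bool) (t : nat) : bool :=
  halting (cur (run M w t)).

(* The output is the content of the last tape, which is required to be blank
   beyond the output word.  For a one-tape machine it is also the input tape. *)
Definition computes (M : machine) (w u : seq bool) : Prop :=
  exists2 t, halts_at M w t &
    forall p, tape (run M w t) ord_max p = @word_tape (work M) u p.

(** * Sampling algorithms *)

(* The number n is given in unary.  Running times are measured in n itself, so
   this is the same as giving n in binary, up to a polynomial. *)
Definition encode_nat (n : nat) : seq bool := nseq n true.

Fixpoint lex_tuples (m k : nat) : seq (k.-tuple 'I_m) :=
  match k with
  | 0 => [:: [tuple]]
  | k'.+1 => [seq cons_tuple i t | i <- enum 'I_m, t <- lex_tuples m k']
  end.

(* The size in unary, a separator, and for each relation symbol in turn the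
   table of the characteristic function of the relation. *)
Definition encode_structure (tau : signature) (m : nat)
    (B : finstructure tau m) : seq bool :=
  nseq m true ++ false ::
  flatten [seq [seq t \in B R | t <- lex_tuples m (arity R)]
          | R <- enum (symbol tau)].

Definition outputs (tau : signature) (M : machine) (n m : nat)
    (B : finstructure tau m) : Prop :=
  computes M (encode_nat n) (encode_structure B).

Definition is_sample (tau : signature) (D : Type) (Gamma : structure tau D)
    (n m : nat) (B : finstructure tau m) : Prop :=
  (exists S : pred D, isomorphic (structure_of_fin B) (induced Gamma S)) /\
  forall (T : finType) (A : structure tau T), #|T| = n ->
    (homomorphic A (structure_of_fin B) <-> homomorphic A Gamma).

Definition sampling_algorithm (tau : signature) (D : Type)
    (Gamma : structure tau D) (M : machine) : Prop :=
  forall n, 0 < n ->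
    exists (m : nat) (B : finstructure tau m),
      outputs M n B /\ is_sample Gamma n B.

Definition efficient (M : machine) : Prop :=
  exists p : {poly nat}, forall n, 0 < n ->
    exists2 t, t <= p.[n]%R & halts_at M (encode_nat n) t.

(* Main.v *)
From HB Require Import structures.
Require Import Defs.
From mathcomp Require Import all_boot all_order all_algebra.
From mathcomp Require Import boolp.

(** By back-and-forth, membership in a relation that is first-order definable
    in (Q;<) depends only on the order type of the tuple.  Hence the
    substructure induced on {0, ..., n-1} is a sample for n: a homomorphism f
    from a structure with n elements to Gamma can be replaced by its rank
    function x |-> #{y | f y < f x}.

    The machine turns the unary input into a strip of n cells on which the
    current tuple is stored by marking, for each coordinate j, the cell whose
    position is the value of j.  One sweep to the right replaces the tuple by
    its lexicographic successor and collects in the state the order type of the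
    new tuple, which determines the bit to output, and the set of coordinates
    with value n-1, which determines the coordinate to increment next. *)

Set Implicit Arguments.
Unset Strict Implicit.
Unset Printing Implicit Defensive.

Import Order.TTheory GRing.Theory Num.Theory.

(** * Definable relations depend on order types only *)

(** The rationals have no endpoints, which gives [y - 1] and [x + 1], and they are dense, which
    gives the midpoint. *)
Lemma rat_separation (X Y : seq rat) :
  {in X & Y, forall x y, (x < y)%R} ->
  exists2 b : rat, {in X, forall x, (x < b)%R} & {in Y, forall y, (b < y)%R}.
Proof.
elim: X => [|x X IHX] XY.
  elim: Y {XY} => [|y Y [b _ bY]]; first by exists 0%R.
  exists (Num.min b (y - 1))%R => // z.
  rewrite inE gt_min => /predU1P[->|/bY->//].
  by rewrite ltrBlDr ltrDl ltr01 orbT.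
have [c xc cY] : exists2 c : rat, (x < c)%R & {in Y, forall y, (c < y)%R}.
  have : {in Y, forall y, (x < y)%R}.
    by move=> y Yy; apply: XY => //; rewrite mem_head.
  elim: Y {IHX XY} => [|y Y IHY] xY; first by exists (x + 1)%R; rewrite ?ltrDl.
  have [z Yz|c xc cY] := IHY; first by apply: xY; rewrite inE Yz orbT.
  have xy : (x < y)%R by apply: xY; rewrite mem_head.
  have [xm my] := midf_lt xy.
  exists (Num.min c ((x + y) / 2))%R => [|z]; first by rewrite lt_min xc xm.
  by rewrite inE gt_min => /predU1P[->|/cY->//]; rewrite my orbT.
have [z y Xz|b Xb bY] := IHX; first by apply: XY; rewrite inE Xz orbT.
exists (Num.max b c) => [z|y Yy]; last by rewrite gt_max bY ?cY.
by rewrite inE lt_max => /predU1P[->|/Xb->//]; rewrite xc orbT.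
Qed.

(** Strict comparisons suffice: the order is linear, so they determine which entries are equal. *)
Definition same_order (k : nat) (v w : k.-tuple rat) : Prop :=
  forall i j, (tnth v i < tnth v j)%R = (tnth w i < tnth w j)%R.

Lemma same_order_eq (k : nat) (v w : k.-tuple rat) : same_order v w ->
  forall i j, (tnth v i == tnth v j) = (tnth w i == tnth w j).
Proof. by move=> vw i j; rewrite !eq_le !leNgt !vw. Qed.

Lemma same_order_sym (k : nat) (v w : k.-tuple rat) :
  same_order v w -> same_order w v.
Proof. by move=> vw i j; rewrite vw. Qed.

(** The back-and-forth step. If [a] is an entry of [v], the entry of [w] with the same index serves;
    otherwise [a] cuts the entries of [v] in two, and [b] is chosen in the corresponding cut of
    [w]. *)
Lemma same_order_extend (k : nat) (v w : k.-tuple rat) (a : rat) :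
  same_order v w ->
  exists b : rat, same_order (cons_tuple a v) (cons_tuple b w).
Proof.
move=> vw.
suff [b bP] : exists b : rat, forall i,
    (a < tnth v i)%R = (b < tnth w i)%R /\ (tnth v i < a)%R = (tnth w i < b)%R.
  exists b => i j.
  case: (unliftP ord0 i) => [i'|] ->; case: (unliftP ord0 j) => [j'|] ->;
    by rewrite ?tnthS ?tnth0 ?ltxx ?(bP _).1 ?(bP _).2.
have [[i <-]|Na] := pselect (exists i, tnth v i = a).
  by exists (tnth w i) => j; rewrite !vw.
pose lo := [seq tnth w i | i <- enum 'I_k & (tnth v i < a)%R].
pose hi := [seq tnth w i | i <- enum 'I_k & (a < tnth v i)%R].
have [x y|b lob bhi] := @rat_separation lo hi.
  case/mapP=> i; rewrite mem_filter => /andP[ia _] ->.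
  case/mapP=> j; rewrite mem_filter => /andP[aj _] ->.
  by rewrite -vw (lt_trans ia aj).
exists b => i.
have [ia|ai|ia] := ltgtP (tnth v i) a; last by case: Na; exists i.
  have ib : (tnth w i < b)%R.
    by apply/lob/mapP; exists i; rewrite // mem_filter ia mem_enum.
  by split; rewrite ?ib // ltNge ltW.
have bi : (b < tnth w i)%R.
  by apply/bhi/mapP; exists i; rewrite // mem_filter ai mem_enum.
by split; rewrite ?bi // ltNge ltW.
Qed.

Lemma satisfies_same_order (k : nat) (phi : formula order_signature k)
    (v w : k.-tuple rat) :
  same_order v w -> satisfies rat_order phi v <-> satisfies rat_order phi w.
Proof.
elim: phi v w => {k} /=.
- by move=> k R x v w vw; rewrite /rat_order !tnth_map vw.
- move=> k x y v w vw.
  by split=> /eqP; [rewrite (same_order_eq vw)|rewrite -(same_order_eq vw)]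
    => /eqP.
- by move=> k phi IH v w /IH <-.
- by move=> k phi IH psi IH' v w vw; rewrite (IH _ _ vw) (IH' _ _ vw).
- by move=> k phi IH psi IH' v w vw; rewrite (IH _ _ vw) (IH' _ _ vw).
- move=> k phi IH v w vw; split=> -[a aP].
    by have [b /IH ab] := same_order_extend a vw; exists b; apply/ab.
  have [b /IH ab] := same_order_extend a (same_order_sym vw).
  by exists b; apply/ab.
(* Here [a] extends the tuple of the conclusion, so it is carried back to the other tuple. *)
- move=> k phi IH v w vw; split=> aP a.
    have [b /IH ab] := same_order_extend a (same_order_sym vw); exact/ab.
  by have [b /IH ab] := same_order_extend a vw; apply/ab.
Qed.

Lemma fo_definable_same_order (k : nat) (P : k.-tuple rat -> Prop)
    (v w : k.-tuple rat) :
  fo_definable rat_order P -> same_order v w -> P v -> P w.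
Proof.
by case=> phi Pphi vw /Pphi vP; apply/Pphi/(satisfies_same_order phi vw).
Qed.

(** * The sample *)

Definition rat_of_ord (n : nat) (i : 'I_n) : rat := (i%:R)%R.

Lemma rat_of_ord_lt (n : nat) (i j : 'I_n) :
  (rat_of_ord i < rat_of_ord j)%R = (i < j).
Proof. by rewrite ltr_nat. Qed.

Lemma rat_of_ord_inj (n : nat) : injective (@rat_of_ord n).
Proof. by move=> i j /eqP; rewrite eqr_nat => /eqP/val_inj. Qed.

Definition initial_segment (tau : signature) (Gamma : structure tau rat)
    (n : nat) : finstructure tau n :=
  fun R => [set t | `[< Gamma R (map_tuple (@rat_of_ord n) t) >]].

Lemma initial_segmentP (tau : signature) (Gamma : structure tau rat) (n : nat)
    (R : symbol tau) (t : (arity R).-tuple 'I_n) :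
  structure_of_fin (initial_segment Gamma n) t <->
  Gamma R (map_tuple (@rat_of_ord n) t).
Proof. by rewrite /structure_of_fin inE; split=> /asboolP. Qed.

Lemma initial_segment_isomorphic (tau : signature) (Gamma : structure tau rat)
    (n : nat) :
  exists S : pred rat,
    isomorphic (structure_of_fin (initial_segment Gamma n)) (induced Gamma S).
Proof.
pose S : pred rat := fun q => [exists i : 'I_n, q == rat_of_ord i].
have fS (i : 'I_n) : S (rat_of_ord i) by apply/existsP; exists i.
exists S, (fun i => exist (fun q => S q) (rat_of_ord i) (fS i)); split.
  have gS (x : {q | S q}) : exists i : 'I_n, sval x == rat_of_ord i.
    exact/existsP/(svalP x).
  exists (fun x => xchoose (gS x)) => [i|x].
    by apply: rat_of_ord_inj; rewrite -(eqP (xchooseP (gS _))).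
  by apply: val_inj; rewrite /= -(eqP (xchooseP (gS x))).
move=> R t; apply: (iff_trans (initial_segmentP _ _)); rewrite /induced.
set u := map_tuple sval _; suff -> : u = map_tuple (@rat_of_ord n) t by [].
by apply: val_inj; rewrite /= -map_comp.
Qed.

Lemma initial_segment_sample (tau : signature) (Gamma : structure tau rat)
    (n : nat) :
  (forall R : symbol tau, fo_definable rat_order (Gamma R)) ->
  is_sample Gamma n (initial_segment Gamma n).
Proof.
move=> GammaD; split=> [|T A cardT]; first exact: initial_segment_isomorphic.
split=> -[f fP].
  exists (@rat_of_ord n \o f) => R t /fP/initial_segmentP.
  by congr (Gamma R _); apply: val_inj; rewrite /= map_comp.
(* The rank stays below [n] because [x] does not count itself. *)
have rank_ltn x : #|[pred y | (f y < f x)%R]| < n.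
  rewrite -cardT; apply/proper_card/properP; split; first exact/subset_predT.
  by exists x => //; rewrite inE ltxx.
pose g x := Ordinal (rank_ltn x).
have gE x y : (g x < g y) = (f x < f y)%R.
  have [xy|yx] := ltP (f x) (f y).
    apply/proper_card/properP; split.
      by apply/subsetP=> z; rewrite !inE => /lt_trans; apply.
    by exists x; rewrite !inE ?ltxx.
  apply/negbTE; rewrite -leqNgt; apply/subset_leq_card/subsetP=> z.
  by rewrite !inE => /lt_le_trans; apply.
exists g => R t /fP GR; apply/initial_segmentP; move: GR.
apply: (fo_definable_same_order (GammaD R)) => i j.
by rewrite !tnth_map rat_of_ord_lt gE.
Qed.

(** * Lexicographic enumeration by carrying *)

Fixpoint lex_seqs (n k : nat) : seq (seq nat) :=
  if k is k'.+1 then [seq i :: t | i <- iota 0 n, t <- lex_seqs n k']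
  else [:: [::]].

Lemma map_val_lex_tuples (n k : nat) :
  [seq [seq val i | i <- val t] | t <- lex_tuples n k] = lex_seqs n k.
Proof.
elim: k => [|k IHk] //=.
rewrite -IHk -val_enum_ord allpairs_mapl allpairs_mapr map_allpairs.
exact: eq_allpairs.
Qed.

Lemma size_lex_seqs (n k : nat) : size (lex_seqs n k) = n ^ k.
Proof. by elim: k => //= k IHk; rewrite size_allpairs size_iota IHk expnS. Qed.

Lemma lex_seqsP (n k : nat) (s : seq nat) :
  s \in lex_seqs n k -> size s = k /\ all (ltn^~ n) s.
Proof.
elim: k s => [|k IHk] s /=; first by rewrite inE => /eqP->.
case/allpairsP=> -[i t] /= [+ /IHk[<- tn] ->] /=.
by rewrite mem_iota /= => ->.
Qed.

(* One plus the index of the last [false], or [0] if there is none. *)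
Fixpoint carry_index (b : seq bool) : nat :=
  if b is x :: b' then
    if carry_index b' is r.+1 then r.+2 else ~~ x
  else 0.

Lemma carry_index_size (b : seq bool) : carry_index b <= size b.
Proof. by elim: b => //= x b; case: (carry_index b) => //; case: x. Qed.

(* For [r > 0] increments coordinate [r.-1] and resets the later ones; for
   [r = 0] resets all of them. *)
Definition advance (r : nat) (v : nat -> nat) (j : nat) : nat :=
  if j.+1 < r then v j else if j.+1 == r then (v j).+1 else 0.

(** For entries below [n], the coordinates after the last one different from [n.-1] overflow, so
    this selects the coordinate to increment; 0 signals the end of the table. *)
Definition carry (n : nat) (s : seq nat) : nat :=
  carry_index [seq i == n.-1 | i <- s].

Definition succ_seq (n : nat) (s s' : seq nat) : bool :=
  (0 < carry n s) &&
  (s' == mkseq (advance (carry n s) (nth 0 s)) (size s)).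

Lemma carry_size (n : nat) (s : seq nat) : carry n s <= size s.
Proof. by rewrite -(size_map (eq_op^~ n.-1)) carry_index_size. Qed.

Lemma carry_max (n k : nat) : carry n (nseq k n.-1) = 0.
Proof. by rewrite /carry; elim: k => //= k ->; rewrite eqxx. Qed.

(** Past the end of [s] both sides are 0; all indices matter because the machine has [K.+1] marks
    whatever the arity. *)
Lemma succ_seq_nth (n : nat) (s s' : seq nat) : succ_seq n s s' ->
  forall j, nth 0 s' j = advance (carry n s) (nth 0 s) j.
Proof.
case/andP=> _ /eqP-> j; have [js|sj] := ltnP j (size s).
  by rewrite nth_mkseq.
rewrite nth_default ?size_mkseq // /advance.
have cj : carry n s < j.+1 by apply: leq_ltn_trans (carry_size n s) _.
by rewrite ltnNge ltnW //= gtn_eqF.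
Qed.

Lemma succ_seq_cons (n i : nat) (s s' : seq nat) :
  succ_seq n s s' -> succ_seq n (i :: s) (i :: s').
Proof.
case/andP=> c_gt0 /eqP->; rewrite /succ_seq /carry /=.
rewrite /carry in c_gt0 *; case: carry_index c_gt0 => //= r _.
rewrite {2}/mkseq /= -[1]addn1 addnC iotaDl -map_comp.
by apply/eqP; congr (_ :: _); apply: eq_map => j; rewrite /advance /= !ltnS.
Qed.

(** The tail is exhausted, so the carry reaches the head. *)
Lemma succ_seq_head (n i k : nat) : i < n.-1 ->
  succ_seq n (i :: nseq k n.-1) (i.+1 :: nseq k 0).
Proof.
move=> in1; rewrite /succ_seq /carry /=.
move: (carry_max n k); rewrite /carry => ->.
rewrite (ltn_eqF in1) size_nseq /=; apply/eqP.
rewrite {1}/mkseq /=; congr (_ :: _).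
apply: (@eq_from_nth _ 0); rewrite size_nseq ?size_map ?size_iota // => j jk.
by rewrite nth_nseq jk (nth_map 0) ?size_iota // nth_iota //.
Qed.

(** Tuples with a fixed first entry form a block that repeats the list for [k]: [succ_seq_cons]
    covers the steps inside a block, [succ_seq_head] those between blocks. *)
Lemma lex_seqs_succ (n k : nat) : 0 < n ->
  exists s, [/\ lex_seqs n k = nseq k 0 :: s,
    path (succ_seq n) (nseq k 0) s & last (nseq k 0) s = nseq k n.-1].
Proof.
move=> n_gt0; elim: k => [|k [s [lexE sP lastE]]] /=; first by exists [::].
have block i t : path (succ_seq n) t s ->
    path (succ_seq n) (i :: t) [seq i :: t | t <- s].
  by elim: s t {lexE sP lastE} => //= u s IHs t /andP[/succ_seq_cons-> /IHs].
(* Generalized to the last [m.+1] blocks, with first entries from [i] to [n.-1], for an induction on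
   [m]. *)
suff main m i : i + m = n.-1 -> exists s',
  [/\ [seq j :: t | j <- iota i m.+1, t <- lex_seqs n k]
      = (i :: nseq k 0) :: s',
    path (succ_seq n) (i :: nseq k 0) s'
    & last (i :: nseq k 0) s' = n.-1 :: nseq k n.-1].
  by have [s' s'P] := main n.-1 0 erefl; exists s'; rewrite prednK in s'P.
elim: m i => [|m IHm] i im.
  exists [seq i :: t | t <- s]; rewrite /= cats0 lexE /= block //.
  by rewrite last_map lastE -im addn0.
have [|s' [E s'P s'l]] := IHm i.+1; first by rewrite addSnnS.
exists ([seq i :: t | t <- s] ++ (i.+1 :: nseq k 0) :: s').
rewrite allpairs_cons E lexE /= cat_path last_cat block //= last_map lastE.
by rewrite succ_seq_head ?s'P // -im addnS ltnS leq_addr.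
Qed.

(** * The machine *)

(* [Sweep R r prev last seen L]: the tuple is being advanced by [r] for the
   symbol [R]; [prev] and [last] are the old and the new mark set of the cell to
   the left of the head, [seen] is the set of the coordinates whose new value is
   left of the head, and [L] is the strict order among them. *)
Inductive sampler_state (S : finType) (K : nat) : Type :=
| Copy of bool
| Rewind of option S & 'I_K.+1
| Sweep of S & 'I_K.+1 & {set 'I_K.+1} & {set 'I_K.+1} & {set 'I_K.+1}
    & {set 'I_K.+1 * 'I_K.+1}.
Arguments Copy {S K} _.
Arguments Rewind {S K} _ _.
Arguments Sweep {S K} _ _ _ _ _ _.

Definition sampler_code (S : finType) (K : nat) (q : sampler_state S K) :=
  match q with
  | Copy b => inl (inl b)
  | Rewind o r => inl (inr (o, r))
  | Sweep R r prev last seen L => inr (R, r, prev, last, seen, L)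
  end.

Definition sampler_decode (S : finType) (K : nat)
    (x : bool + option S * 'I_K.+1 +
      S * 'I_K.+1 * {set 'I_K.+1} * {set 'I_K.+1} * {set 'I_K.+1} *
      {set 'I_K.+1 * 'I_K.+1}) : sampler_state S K :=
  match x with
  | inl (inl b) => Copy b
  | inl (inr (o, r)) => Rewind o r
  | inr (R, r, prev, last, seen, L) => Sweep R r prev last seen L
  end.

Lemma sampler_codeK (S : finType) (K : nat) :
  cancel (@sampler_code S K) (@sampler_decode S K).
Proof. by case. Qed.

HB.instance Definition _ (S : finType) (K : nat) :=
  Finite.copy (sampler_state S K) (can_type (@sampler_codeK S K)).

Section Sampler.

Variables (S : finType) (ar : S -> nat) (K : nat).
Variable accept : S -> {set 'I_K.+1 * 'I_K.+1} -> bool.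
Hypothesis ar_le : forall R, ar R <= K.

(** One type serves both for coordinates, which are below [K], and for carry indices, which go up to
    [K]. *)
Local Notation mark := 'I_K.+1.
Local Notation sstate := (sampler_state S K).

(* The flag is raised on the leftmost cell only; the set consists of the
   coordinates whose current value is the position of the cell. *)
Definition sampler_work : finType := (bool * {set mark})%type.

Definition next_symbol (R : S) : option S :=
  ohead (drop (index R (enum S)).+1 (enum S)).

Definition pair_action (A : Type) (a b : A) : 'I_2 -> A :=
  fun i => if i == ord0 then a else b.

(** The local form of [advance]: the mark of the incremented coordinate comes from the cell to the
    left, and reset coordinates are marked on the flagged cell. *)
Definition advance_marks (r : nat) (prev s : {set mark}) (f : bool) :
    {set mark} :=
  [set j : mark | if j.+1 < r then j \in s
                  else if j.+1 == r then j \in prev else f].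

(** [Copy] builds the strip and outputs the size and the separator; [Rewind] seeks the flag; [Sweep]
    ends at the blank behind the strip, where it outputs one bit. *)
Definition sampler_trans (q : sstate)
    (c : {ffun 'I_2 -> cell sampler_work}) :
    sstate * ('I_2 -> cell sampler_work * move) :=
  match q with
  | Copy f =>
      if c ord0 is Some _ then
        (Copy false, pair_action (Some (inr (f, set0)), MoveRight)
                                 (Some (inl true), MoveRight))
      else (Rewind (ohead (enum S)) ord0,
            pair_action (None, MoveLeft) (Some (inl false), MoveRight))
  | Rewind (Some R) r =>
      if c ord0 is Some (inr (true, _)) then
        (Sweep R r set0 set0 set0 set0,
         pair_action (c ord0, Stay) (c ord_max, Stay))
      else (q, pair_action (c ord0, MoveLeft) (c ord_max, Stay))
  | Rewind None _ => (q, pair_action (c ord0, Stay) (c ord_max, Stay))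
  | Sweep R r prev last seen L =>
      if c ord0 is Some (inr (f, s)) then
        let s' := advance_marks r prev s f in
        (Sweep R r s s' (seen :|: s') (L :|: setX seen s'),
         pair_action (Some (inr (f, s')), MoveRight) (c ord_max, Stay))
      else
        let r' := carry_index (mkseq (fun j => inord j \in last) (ar R)) in
        (Rewind (if r' == 0 then next_symbol R else Some R) (inord r'),
         pair_action (None, MoveLeft) (Some (inl (accept R L)), MoveRight))
  end.

Definition sampler_halting (q : sstate) : bool :=
  if q is Rewind None _ then true else false.

Definition sampler : machine :=
  @Machine 1 sstate sampler_work (Copy true) sampler_halting sampler_trans.

(** * Configurations and single steps *)

Definition conf (q : sstate) (T : nat -> cell sampler_work) (p : nat)
    (out : seq bool) : config sampler :=
  @Config sampler q (fun i => if i == ord0 then T else word_tape _ out)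
    (fun i => if i == ord0 then p else size out).

Lemma word_tape_rcons (W : finType) (out : seq bool) (b : bool) :
  @word_tape W (rcons out b) =
  fun x => if x == size out then Some (inl b) else word_tape W out x.
Proof.
apply: funext => x; rewrite /word_tape map_rcons nth_rcons size_map.
by case: ltngtP => // sx; rewrite nth_default // size_map ltnW.
Qed.

(** The output head stands just behind the output, so writing a bit appends it. *)
Lemma step_write (q q' : sstate) (T : nat -> cell sampler_work) (p : nat)
    (out : seq bool) (x : cell sampler_work) (m : move) (b : bool) :
  ~~ sampler_halting q ->
  (forall c : {ffun _}, c ord0 = T p ->
    sampler_trans q c =
    (q', pair_action (x, m) (Some (inl b), MoveRight))) ->
  step (conf q T p out) =
  conf q' (fun y => if y == p then x else T y) (shift m p) (rcons out b).
Proof.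
move=> Nq qE; rewrite /step /= (negbTE Nq) qE ?ffunE //=.
rewrite /conf word_tape_rcons size_rcons; congr Config; apply: funext => i.
  by apply: funext => y; rewrite /pair_action; case: (i == ord0).
by rewrite /pair_action; case: (i == ord0).
Qed.

Lemma step_silent (q q' : sstate) (T : nat -> cell sampler_work) (p : nat)
    (out : seq bool) (x : cell sampler_work) (m : move) :
  ~~ sampler_halting q ->
  (forall c : {ffun _}, c ord0 = T p ->
    sampler_trans q c = (q', pair_action (x, m) (c ord_max, Stay))) ->
  step (conf q T p out) =
  conf q' (fun y => if y == p then x else T y) (shift m p) out.
Proof.
move=> Nq qE; rewrite /step /= (negbTE Nq) qE ?ffunE //=.
rewrite /conf; congr Config; apply: funext => i.
  apply: funext => y; rewrite /pair_action; case: (i == ord0) => //=.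
  by case: eqP => // ->.
by rewrite /pair_action; case: (i == ord0).
Qed.

(** * Sweeps, rounds and tables on the marked strip *)

Definition marks (v : nat -> nat) (p : nat) : {set mark} :=
  [set j : mark | v j == p].

Definition marked (n : nat) (v : nat -> nat) (p : nat) : cell sampler_work :=
  if p < n then Some (inr (p == 0, marks v p)) else None.

(** The bound [n] makes this what a sweep has collected when it arrives at position [n]. *)
Definition order_pattern (v : nat -> nat) (n : nat) : {set mark * mark} :=
  [set ij : mark * mark | v ij.1 < v ij.2 < n].

Lemma advance_marksE (r p : nat) (v : nat -> nat) :
  advance_marks r (if p is p'.+1 then marks v p' else set0) (marks v p)
    (p == 0) = marks (advance r v) p.
Proof.
apply/setP=> j; rewrite !inE /advance; case: ltngtP => // _.
by case: p => [|p]; rewrite inE.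
Qed.

(** The loop invariant of the sweep. The old marks of the cell to the left are kept in the state
    because that cell is already overwritten. *)
Lemma run_sweep (n p : nat) (R : S) (r : mark) (v : nat -> nat)
    (out : seq bool) : p <= n ->
  let v' := advance r v in
  iter p (@step sampler)
    (conf (Sweep R r set0 set0 set0 set0) (marked n v) 0 out) =
  conf (Sweep R r (if p is p'.+1 then marks v p' else set0)
          (if p is p'.+1 then marks v' p' else set0)
          [set j : mark | v' j < p] (order_pattern v' p))
    (fun x => if x < p then marked n v' x else marked n v x) p out.
Proof.
move=> + v'; elim: p => [|p IHp] pn.
  rewrite /=; congr (conf (Sweep _ _ _ _ _ _));
    by apply/setP=> j; rewrite !inE ?ltn0 ?andbF.
rewrite iterS IHp; last exact: ltnW.
rewrite (@step_silent _ (Sweep R r (marks v p) (marks v' p)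
  [set j : mark | v' j < p.+1] (order_pattern v' p.+1)) _ _ _
  (marked n v' p) MoveRight) //.
  congr conf; apply: funext => x; rewrite (ltnS x p) (leq_eqVlt x p).
  by case: (x =P p) => [->|].
move=> c; rewrite ltnn /marked pn => E /=; rewrite E advance_marksE -/v'.
congr (Sweep _ _ _ _ _ _, _); apply/setP=> j.
  by rewrite !inE (ltnS (v' j)) (leq_eqVlt (v' j)) orbC.
rewrite !inE (ltnS (v' j.2)) (leq_eqVlt (v' j.2)) andb_orr orbC.
by case: (v' j.2 =P p) => [->|]; rewrite ?andbT // !andbF.
Qed.

Lemma run_rewind (n p : nat) (R : S) (r : mark) (v : nat -> nat)
    (out : seq bool) : p < n ->
  iter p.+1 (@step sampler) (conf (Rewind (Some R) r) (marked n v) p out) =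
  conf (Sweep R r set0 set0 set0 set0) (marked n v) 0 out.
Proof.
elim: p => [|p IHp] pn; rewrite iterSr.
  rewrite (@step_silent _ (Sweep R r set0 set0 set0 set0) _ _ _
    (marked n v 0) Stay) //.
    by congr conf; apply: funext => x; case: eqP => [->|].
  by move=> c; rewrite /marked pn => E /=; rewrite E.
rewrite (@step_silent _ (Rewind (Some R) r) _ _ _ (marked n v p.+1)
  MoveLeft) //.
  rewrite -{}IHp; last exact: ltnW.
  by congr iter; congr conf; apply: funext => x; case: eqP => [->|].
by move=> c; rewrite /marked pn => E /=; rewrite E.
Qed.

(** Rewinding and the change of state take [n] steps, the sweep [n], and the output of the bit
    one. *)
Definition round_time (n : nat) : nat := n + n.+1.

Lemma run_round (n : nat) (R : S) (r : mark) (v : nat -> nat) (t : seq nat)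
    (out : seq bool) :
  0 < n -> size t = ar R -> nth 0 t =1 advance r v ->
  iter (round_time n) (@step sampler)
    (conf (Rewind (Some R) r) (marked n v) n.-1 out) =
  conf (Rewind (if carry n t == 0 then next_symbol R else Some R)
         (inord (carry n t)))
    (marked n (nth 0 t)) n.-1
    (rcons out (accept R (order_pattern (nth 0 t) n))).
Proof.
move=> n_gt0 tsize /funext tE; rewrite /round_time addnC iterD.
have -> : iter n (@step sampler)
    (conf (Rewind (Some R) r) (marked n v) n.-1 out) =
    conf (Sweep R r set0 set0 set0 set0) (marked n v) 0 out.
  by case: n n_gt0 => // n _; apply: run_rewind.
rewrite iterS run_sweep // -tE.
case: n n_gt0 => // n _ /=.
(* After the case split the strip has [n.+1] cells, so [last] holds the coordinates of maximal value
   [n], and the machine computes [carry]. *)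
have lastE : mkseq (fun j => inord j \in marks (nth 0 t) n) (ar R) =
    [seq i == n | i <- t].
  rewrite -tsize; apply: (@eq_from_nth _ false);
    rewrite ?size_mkseq ?size_map //.
  move=> j jt; rewrite nth_mkseq // (nth_map 0) // inE inordK // ltnS.
  by rewrite (leq_trans (ltnW jt)) // tsize.
rewrite (@step_write _
  (Rewind (if carry n.+1 t == 0 then next_symbol R else Some R)
    (inord (carry n.+1 t))) _ _ _ None MoveLeft
  (accept R (order_pattern (nth 0 t) n.+1))) //.
  congr conf; apply: funext => x; rewrite /marked.
  by case: (ltngtP x n.+1).
by move=> c; rewrite ltnn /marked ltnn => E /=; rewrite E lastE.
Qed.

(** Each round leaves the carry index for the next one; it is positive until the last tuple, where 0
    passes control to the next symbol. *)
Lemma run_table (n : nat) (R : S) (r : mark) (v : nat -> nat) (t : seq nat)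
    (s : seq (seq nat)) (out : seq bool) :
  0 < n -> nth 0 t =1 advance r v ->
  {in t :: s, forall u, size u = ar R} ->
  path (succ_seq n) t s -> carry n (last t s) = 0 ->
  iter (size (t :: s) * round_time n) (@step sampler)
    (conf (Rewind (Some R) r) (marked n v) n.-1 out) =
  conf (Rewind (next_symbol R) ord0) (marked n (nth 0 (last t s))) n.-1
    (out ++ [seq accept R (order_pattern (nth 0 u) n) | u <- t :: s]).
Proof.
move=> n_gt0; elim: s t r v out => [|u s IHs] t r v out tE sizeE.
  move=> _ /= c0; rewrite mul1n (run_round _ _ _ tE) ?c0 ?sizeE ?mem_head //.
  rewrite cats1; congr (conf (Rewind _ _)).
  by apply: val_inj; rewrite /= inordK.
case/andP=> tu us lastE; rewrite [size _]/= mulSn addnC iterD.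
rewrite (run_round _ _ _ tE) ?sizeE ?mem_head //.
have /andP[c_gt0 _] := tu.
rewrite eqn0Ngt c_gt0; apply: etrans (IHs u _ _ _ _ _ us lastE) _.
- move=> j; rewrite (succ_seq_nth tu) inordK // ltnS.
  by rewrite (leq_trans (carry_size _ _)) // sizeE ?mem_head.
- by move=> w ws; apply: sizeE; rewrite inE ws orbT.
- by rewrite cat_rcons.
Qed.

Definition table (n : nat) (R : S) : seq bool :=
  [seq accept R (order_pattern (nth 0 u) n) | u <- lex_seqs n (ar R)].

Lemma next_symbolE (s1 s2 : seq S) (R : S) :
  enum S = s1 ++ R :: s2 -> next_symbol R = ohead s2.
Proof.
move=> E; have := enum_uniq S; rewrite E cat_uniq /= => /and3P[_ Rs1 _].
rewrite /next_symbol E index_cat /= eqxx addn0.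
case: ifP => [Rin|_]; first by rewrite Rin in Rs1.
by rewrite drop_cat ltnNge leqnSn /= subSnn /= drop0.
Qed.

(** Any [v] is allowed because carry index 0 resets all coordinates at the start of a table. *)
Lemma run_tables (n : nat) (s1 s2 : seq S) (v : nat -> nat) (out : seq bool) :
  0 < n -> enum S = s1 ++ s2 ->
  exists v' : nat -> nat,
  iter (\sum_(R <- s2) n ^ ar R * round_time n) (@step sampler)
    (conf (Rewind (ohead s2) ord0) (marked n v) n.-1 out) =
  conf (Rewind None ord0) (marked n v') n.-1
    (out ++ flatten [seq table n R | R <- s2]).
Proof.
move=> n_gt0; elim: s2 s1 v out => [|R s2 IHs] s1 v out E.
  by exists v; rewrite big_nil cats0.
have [s [lexE sP sl]] := lex_seqs_succ (ar R) n_gt0.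
have E' : enum S = rcons s1 R ++ s2 by rewrite cat_rcons.
have [v' v'E] := IHs _ (nth 0 (last (nseq (ar R) 0) s)) (out ++ table n R) E'.
exists v'; rewrite big_cons addnC iterD /= catA -v'E; congr iter.
rewrite /table -(size_lex_seqs n (ar R)) lexE -(next_symbolE E) run_table //.
- by move=> j; rewrite nth_nseq if_same /advance ltn0.
- by move=> u; rewrite -lexE => /lex_seqsP[].
- by rewrite sl carry_max.
Qed.

(** * The complete run *)

Lemma run_copy (n p : nat) : p <= n ->
  iter p (@step sampler) (init sampler (nseq n true)) =
  conf (Copy (p == 0))
    (fun x => if x < p then Some (inr (x == 0, set0))
              else word_tape _ (nseq n true) x) p (nseq p true).
Proof.
elim: p => [|p IHp] pn.
  rewrite /init /conf; congr Config; apply: funext => i; last by case: eqP.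
  rewrite /=; case: eqP => // _; apply: funext => x.
  by rewrite /word_tape nth_nil.
rewrite iterS IHp; last exact: ltnW.
rewrite (@step_write _ (Copy false) _ _ _ (Some (inr (p == 0, set0))) MoveRight
  true) //.
  congr conf; last by rewrite -cats1 -[[:: true]]/(nseq 1 true) -nseqD addn1.
  apply: funext => x; rewrite (ltnS x p) (leq_eqVlt x p).
  by case: (x =P p) => [->|].
move=> c; rewrite ltnn /word_tape map_nseq nth_nseq pn => E /=.
by rewrite E.
Qed.

Definition sampler_output (n : nat) : seq bool :=
  nseq n true ++ false :: flatten [seq table n R | R <- enum S].

Definition sampler_time (n : nat) : nat :=
  n.+1 + \sum_(R : S) n ^ ar R * round_time n.

Lemma run_sampler (n : nat) : 0 < n ->
  exists T, run sampler (nseq n true) (sampler_time n) =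
    conf (Rewind None ord0) T n.-1 (sampler_output n).
Proof.
move=> n_gt0; rewrite /run /sampler_time addnC iterD iterS run_copy //.
rewrite (@step_write _ (Rewind (ohead (enum S)) ord0) _ _ _ None MoveLeft
  false) //; last first.
  move=> c; rewrite ltnn /word_tape map_nseq nth_nseq ltnn => E /=.
  by rewrite E.
(* The marks start out of range, at position [n]. *)
have -> : (fun y => if y == n then None
    else if y < n then Some (inr (y == 0, set0))
    else word_tape sampler_work (nseq n true) y) = marked n (fun=> n).
  apply: funext => x; rewrite /marked.
  case: (ltngtP x n) => // xn; last first.
    by rewrite /word_tape map_nseq nth_nseq ltnNge ltnW.
  congr (Some (inr (_, _))); apply/setP=> j; rewrite !inE.
  by rewrite gtn_eqF.
have [v' vE] := run_tables (fun=> n) (rcons (nseq n true) false) n_gt0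
  (esym (cat0s _)).
by exists (marked n v'); rewrite /sampler_output -cat_rcons -vE big_enum.
Qed.

End Sampler.

(** * Correctness of the machine *)

Lemma word_tape_inj (W : finType) (w u : seq bool) :
  @word_tape W w =1 word_tape W u -> w = u.
Proof.
have nthE (z : seq bool) p : word_tape W z p =
    if p < size z then Some (inl (nth false z p)) else None.
  case: ltnP => [pz|zp]; rewrite /word_tape; first by rewrite (nth_map false).
  by rewrite nth_default ?size_map.
move=> wu; have sizeE : size w = size u.
  case: (ltngtP (size w) (size u)) => // lt.
    by have := wu (size w); rewrite !nthE ltnn lt.
  by have := wu (size u); rewrite !nthE ltnn lt.
apply: (@eq_from_nth _ false) => // p pw.
by have := wu p; rewrite !nthE -sizeE pw => -[].
Qed.

Lemma run_halted (M : machine) (w : seq bool) (t d : nat) :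
  halts_at M w t -> run M w (d + t) = run M w t.
Proof.
rewrite /halts_at /run => h; rewrite iterD; elim: d => //= d ->.
by rewrite /step h.
Qed.

(** A halted configuration no longer changes, so both outputs are on the tape at the sum of the two
    halting times. *)
Lemma computes_inj (M : machine) (w u u' : seq bool) :
  computes M w u -> computes M w u' -> u = u'.
Proof.
case=> t ht tu [t' ht' tu']; apply: (@word_tape_inj (work M)) => p.
by rewrite -tu -tu' -(run_halted t' ht) addnC run_halted.
Qed.

(** The first [false] is the separator, and its index is the size. *)
Lemma encode_structure_size (tau : signature) (m m' : nat)
    (B : finstructure tau m) (B' : finstructure tau m') :
  encode_structure B = encode_structure B' -> m = m'.
Proof.
have indexE k s : index false (nseq k true ++ false :: s) = k.
  by elim: k => //= k ->.
by move/(congr1 (index false)); rewrite !indexE.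
Qed.

(** The truth value is classical, but only finitely many pairs of [R] and [L] exist, so the values
    form a finite table inside the transition function. *)
Definition accept (tau : signature) (Gamma : structure tau rat) (K : nat)
    (R : symbol tau) (L : {set 'I_K.+1 * 'I_K.+1}) : bool :=
  `[< exists2 t, Gamma R t &
      forall i j : 'I_(arity R),
        ((inord i, inord j) \in L) = (tnth t i < tnth t j)%R >].

(** The image of [t] realizes its own pattern, and any other witness has the same order type, hence
    the same membership in [Gamma R]. *)
Lemma accept_order_pattern (tau : signature) (Gamma : structure tau rat)
    (K n : nat) (R : symbol tau) (t : (arity R).-tuple 'I_n) :
  arity R <= K -> fo_definable rat_order (Gamma R) ->
  accept Gamma R (order_pattern K (nth 0 [seq val i | i <- t]) n) =
  (t \in initial_segment Gamma n R).
Proof.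
move=> arity_le Gamma_definable.
have patE (i j : 'I_(arity R)) :
    ((inord i, inord j) \in order_pattern K (nth 0 [seq val i | i <- t]) n) =
    (tnth (map_tuple (@rat_of_ord n) t) i
     < tnth (map_tuple (@rat_of_ord n) t) j)%R.
  have tE (k : 'I_(arity R)) :
      nth 0 [seq val i | i <- t] (@inord K k) = tnth t k.
    rewrite inordK; last by rewrite ltnS (leq_trans (ltnW (ltn_ord k))).
    by rewrite (nth_map (tnth t k)) ?size_tuple // -tnth_nth.
  by rewrite inE !tE ltn_ord andbT !tnth_map rat_of_ord_lt.
rewrite inE; apply: asbool_equiv_eq; split=> [[u Gu uE]|Gt]; last first.
  by exists (map_tuple (@rat_of_ord n) t).
apply: (fo_definable_same_order Gamma_definable) Gu => i j.
by rewrite -uE patE.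
Qed.

Lemma encode_initial_segment (tau : signature) (Gamma : structure tau rat)
    (K n : nat) :
  (forall R : symbol tau, arity R <= K) ->
  (forall R : symbol tau, fo_definable rat_order (Gamma R)) ->
  encode_structure (initial_segment Gamma n) =
  sampler_output (@arity tau) (@accept tau Gamma K) n.
Proof.
move=> arity_le Gamma_definable.
congr (_ ++ _ :: flatten _); apply: eq_map => R.
rewrite /table -map_val_lex_tuples -map_comp; apply: eq_map => t /=.
by rewrite accept_order_pattern.
Qed.

Lemma sampler_time_poly (tau : signature) :
  exists p : {poly nat}, forall n, sampler_time (@arity tau) n = p.[n]%R.
Proof.
exists ('X + 1 + \sum_(R : symbol tau) 'X^(arity R) * ('X + ('X + 1)))%R => n.
rewrite !(hornerD, hornerX, hornerC, horner_sum) /sampler_time -addn1.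
congr (_ + _); apply: eq_bigr => R _.
rewrite !(hornerM, hornerD, hornerX, hornerC, hornerXn) /round_time -addn1.
(* Identifies the ring power in [nat] with [expn]. *)
by congr (_ * _); elim: (arity R) => // k IHk; rewrite expnS IHk GRing.exprS.
Qed.

Theorem theorem3p16 (tau : signature) (Gamma : structure tau rat)
    (Gamma_definable :
       forall R : symbol tau, fo_definable rat_order (Gamma R)) :
  exists M : machine,
    [/\ sampling_algorithm Gamma M,
        efficient M &
        forall (n m : nat) (B : finstructure tau m),
          0 < n -> outputs M n B -> m = n].
Proof.
pose K := \max_(R : symbol tau) arity R.
have arity_le (R : symbol tau) : arity R <= K by apply: leq_bigmax.
pose M := sampler (@arity tau) (@accept tau Gamma K).
have haltM n : 0 < n -> halts_at M (encode_nat n) (sampler_time (@arity tau) n).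
  case/(run_sampler (@accept _ Gamma K) arity_le) => T.
  by rewrite /halts_at => ->.
have outM n : 0 < n -> outputs M n (initial_segment Gamma n).
  move=> n_gt0; exists (sampler_time (@arity tau) n); first exact: haltM.
  have [T ->] := run_sampler (@accept _ Gamma K) arity_le n_gt0.
  by rewrite (encode_initial_segment n arity_le Gamma_definable).
exists M; split.
- move=> n n_gt0; exists n, (initial_segment Gamma n).
  by split; [exact: outM | exact: initial_segment_sample].
- have [p pE] := sampler_time_poly tau; exists p => n n_gt0.
  by exists (sampler_time (@arity tau) n); [rewrite pE | exact: haltM].
(* Outputs are unique, so the encoding of [B] is that of the initial segment. *)
- move=> n m B n_gt0 /computes_inj/(_ (outM n n_gt0)).
  exact: encode_structure_size.
Qed.
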